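(* Let $\mathcal{G}$ be a connected undirected graph on $N$ agents with Laplacian matrix $L\in\mathbb{R}^{N\times N}$, and let $\lambda_2(L)$ be the smallest nonzero eigenvalue of $L$. Let $\alpha>0$ and $g(y)=\alpha\,\mathrm{sign}(y)\odot e^{|y|}$, $y\in\mathbb{R}^N$. Then under the dynamics $\dot x=-g(Lx)$, with any initial state $x(0)=x_0\in\mathbb{R}^N$, all the states achieve consensus in a fixed time bounded by $\dfrac{N}{\alpha\lambda_2(L)}$.
   Context: $\mathrm{sign}(y)$ and $e^{|y|}=[e^{|y_i|}]_i$ are taken componentwise with $\mathrm{sign}(0)=0$, and $\odot$ is the componentwise product. ''Consensus in time $T$'' means $x(t)\in\mathrm{span}\{\mathbf{1}_N\}$ (all components equal) for all $t\ge T$. Solutions are Filippov solutions of $\dot x=X(x)$: (locally) absolutely continuous $x:[0,\infty)\to\mathbb{R}^N$ with $\dot x(t)\in\mathcal{F}[X](x(t))$ for a.e. $t$, where $\mathcal{F}[X](x)=\bigcap_{\delta>0}\bigcap_{\omega(\mathcal{N}_0)=0}\overline{co}\{X(x^{\delta}\setminus\mathcal{N}_0)\}$, with $x^\delta$ the open ball of radius $\delta$ at $x$, $\omega$ Lebesgue measure, and $\overline{co}$ the closed convex hull. *)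

(* Defs.v *)
From HB Require Import structures.
From mathcomp Require Export all_boot all_order all_algebra.
From mathcomp Require Export all_classical all_reals all_analysis.
Export Order.TTheory GRing.Theory Num.Theory.
Export numFieldNormedType.Exports.

Set Implicit Arguments.
Unset Strict Implicit.
Unset Printing Implicit Defensive.

Local Open Scope classical_set_scope.
Local Open Scope ring_scope.

(* Undirected graph on the vertices 'I_N, given by its edge weights: {i, j} is
   an edge iff 0 < adj i j. Weights in {0, 1} give the simple graphs. *)
Record undirected_graph (R : realType) (N : nat) := UndirectedGraph {
  adj :> 'M[R]_N ;
  adj_ge0 : forall i j, 0 <= adj i j ;
  adj_sym : forall i j, adj i j = adj j i ;
  adj_loopless : forall i, adj i i = 0
}.

Definition edge (R : realType) (N : nat) (G : undirected_graph R N) : rel 'I_N :=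
  fun i j => 0 < adj G i j.

Definition connected_graph (R : realType) (N : nat) (G : undirected_graph R N) :=
  forall i j, connect (edge G) i j.

Definition laplacian (R : realType) (N : nat) (G : undirected_graph R N) : 'M[R]_N :=
  diag_mx (\row_i \sum_j adj G i j) - adj G.

Definition smallest_nonzero_eigenvalue (R : realType) (N : nat) (A : 'M[R]_N) (l : R) :=
  [/\ eigenvalue A l, l != 0 &
      forall m : R, eigenvalue A m -> m != 0 -> l <= m].

Definition eucl_norm (R : realType) (N : nat) (v : 'cV[R]_N) : R :=
  Num.sqrt (\sum_i v i 0 ^+ 2).

Definition eucl_ball (R : realType) (N : nat) (x : 'cV[R]_N) (d : R) : set 'cV[R]_N :=
  [set z | eucl_norm (z - x) < d].

Definition box (R : realType) (N : nat) (I : 'cV[R]_N * 'cV[R]_N) : set 'cV[R]_N :=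
  [set z | forall i, I.1 i 0 < z i 0 <= I.2 i 0].

Definition box_volume (R : realType) (N : nat) (I : 'cV[R]_N * 'cV[R]_N) : R :=
  \prod_i Num.max 0 (I.2 i 0 - I.1 i 0).

(* Lebesgue outer measure on R^N: infimum of the total volume over countable
   covers by boxes. The covers are indexed by a set of natural numbers so that
   finite and empty covers are allowed. On measurable sets this is Lebesgue
   measure, and a set of outer measure 0 is Lebesgue measurable. *)
Definition lebesgue_outer (R : realType) (N : nat) (A : set 'cV[R]_N) : \bar R :=
  ereal_inf [set m | exists (D : set nat) (I : nat -> 'cV[R]_N * 'cV[R]_N),
    A `<=` \bigcup_(k in D) box (I k) /\
    m = \esum_(k in D) (box_volume (I k))%:E].

Definition closed_convex_hull (R : realType) (N : nat) (A : set 'cV[R]_N) : set 'cV[R]_N :=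
  smallest [set C : set 'cV[R]_N |
    closed C /\ convex_set (C : set (convex_lmodType 'cV[R]_N))] A.

Definition filippov (R : realType) (N : nat) (X : 'cV[R]_N -> 'cV[R]_N)
    (x : 'cV[R]_N) : set 'cV[R]_N :=
  \bigcap_(d in [set d : R | 0 < d])
    \bigcap_(N0 in [set N0 : set 'cV[R]_N | lebesgue_outer N0 = 0%E])
      closed_convex_hull (X @` (eucl_ball x d `\` N0)).

(* For every e there is d such that any finite family of non-overlapping
   subintervals [u i, v i] of [a, b] of total length less than d has total
   variation less than e. *)
Definition absolutely_continuous (R : realType) (a b : R) (f : R -> R) :=
  forall e : R, 0 < e -> exists2 d : R, 0 < d &
    forall (n : nat) (u v : 'I_n -> R),
      (forall i, [/\ a <= u i, u i <= v i & v i <= b]) ->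
      (forall i j, i != j -> v i <= u j \/ v j <= u i) ->
      \sum_i (v i - u i) < d ->
      \sum_i `|f (v i) - f (u i)| < e.

(* Only the values of x on [0, +oo[ matter: the single point t = 0, where
   is_derive is two-sided, is negligible. *)
Definition filippov_solution (R : realType) (N : nat) (X : 'cV[R]_N -> 'cV[R]_N)
    (x : R -> 'cV[R]_N) :=
  (forall (a b : R) (i : 'I_N), 0 <= a -> a <= b ->
     absolutely_continuous a b (fun t => x t i 0)) /\
  {ae lebesgue_measure, forall t : R, 0 <= t ->
     exists2 v : 'cV[R]_N, filippov X (x t) v &
       forall i, is_derive t (1 : R) (fun s : R => x s i 0) (v i 0)}.

Definition sign_exp (R : realType) (N : nat) (alpha : R) (y : 'cV[R]_N) : 'cV[R]_N :=
  \col_i (alpha * (Num.sg (y i 0) * expR `|y i 0|)).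

Definition consensus_in_time (R : realType) (N : nat) (T : R) (x : R -> 'cV[R]_N) :=
  forall t : R, T <= t -> exists c : R, x t = c *: const_mx 1.

(* Main.v *)
Require Import Defs.
From mathcomp Require complex.
From mathcomp Require Import measurable_realfun ring lra.

(** The Lyapunov function is the energy [V = x^T L x], half the weighted sum of
    the squared differences across the ordered pairs of neighbours. Along a
    solution, with [y = L x], its derivative is [2 * y^T v] for some [v] in the
    Filippov set, and this is at most
    [- 2 * alpha * sum_i |y_i| * expR |y_i|] ([filippov_sign_exp]): the
    indeterminacy of the sign at zero is harmless, because it is multiplied by
    [y_i = 0].

    Let [r] be [sqrt (lambda2 * V)]. The spectral gap ([fiedler_gap]) says that
    the norm of [y] is at least [r], and a convexity estimate
    ([sum_mul_expR_ge]) bounds the sum below by [r * expR (r / N)]. Hence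
    [V' <= - 2 * alpha * r * expR (r / N)], and as long as [V > 0] this gives
    [(expR (- r / N))' >= alpha * lambda2 / N]. A quantity with values in
    ]0, 1] cannot grow at that rate on the whole of [0, N / (alpha * lambda2)],
    so the energy vanishes at the end of this interval. It never increases, so it
    stays zero, and on a connected graph zero energy is consensus.

    The differential inequalities hold only almost everywhere. They are
    integrated by [ac_nonincreasing]: an absolutely continuous function whose
    derivative is nonpositive almost everywhere is nonincreasing. *)

Set Implicit Arguments.
Unset Strict Implicit.
Unset Printing Implicit Defensive.
Local Open Scope classical_set_scope.
Local Open Scope ring_scope.

(** * Inner product of column vectors *)

Definition dot (R : realType) (N : nat) (u v : 'cV[R]_N) : R := (u^T *m v) 0 0.

Lemma dotE (R : realType) (N : nat) (u v : 'cV[R]_N) :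
  dot u v = \sum_i u i 0 * v i 0.
Proof. by rewrite /dot mxE; apply: eq_bigr => i _; rewrite mxE. Qed.

Lemma dot_symmetric (R : realType) (N : nat) (A : 'M[R]_N) (u v : 'cV[R]_N) :
  A^T = A -> dot (A *m u) v = dot u (A *m v).
Proof. by move=> AT; rewrite /dot trmx_mul AT mulmxA. Qed.

Lemma dot_ge0 (R : realType) (N : nat) (x : 'cV[R]_N) : 0 <= dot x x.
Proof. by rewrite dotE sumr_ge0// => i _; rewrite -expr2 sqr_ge0. Qed.

Lemma dot_eq0 (R : realType) (N : nat) (x : 'cV[R]_N) : (dot x x == 0) = (x == 0).
Proof.
rewrite dotE psumr_eq0; last by move=> i _; rewrite -expr2 sqr_ge0.
have sqE i : (x i 0 * x i 0 == 0) = (x i 0 == 0) by rewrite -expr2 sqrf_eq0.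
apply/allP/eqP => [x0|-> i _ /=]; last by rewrite !mxE mulr0.
apply/colP => i; have := x0 i (mem_index_enum _).
by rewrite /= mxE sqE => /eqP.
Qed.

(** * Spectral gap of a symmetric matrix *)

Section Spectral.
Import complex.
Local Open Scope sesquilinear_scope.

(** In an orthonormal eigenbasis, with coordinates [w_j] of [x] and eigenvalues
    [d_j], the difference of the two sides is the sum of
    [(d_j ^ 2 - l * d_j) * |w_j| ^ 2]. The eigenbasis is that of [A] as a
    Hermitian matrix over [R[i]]; the [d_j] are real, so they are eigenvalues of
    [A] over [R] as well. *)
Lemma symmetric_quadratic_gap (R : realType) (N : nat) (A : 'M[R]_N) (l : R)
    (x : 'cV[R]_N) :
  A^T = A -> (forall m, eigenvalue A m -> l * m <= m ^+ 2) ->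
  l * dot x (A *m x) <= dot (A *m x) (A *m x).
Proof.
move=> AT eigA.
pose toC : {rmorphism R -> complex R} := real_complex R.
pose B := map_mx toC A.
have Breal : B \is a realmx.
  by apply/mxOverP => i j; rewrite mxE; apply/complex_realP; exists (A i j).
have BT : B^T = B by rewrite /B map_trmx AT.
have Bherm : B \is hermsymmx.
  apply: realsym_hermsym => //; apply/is_hermitianmxP.
  by rewrite expr0 scale1r BT map_mx_id.
have /orthomx_spectralP Bdec := hermitian_normalmx Bherm.
have dreal := hermitian_spectral_diag_real Bherm.
set P := spectralmx B in Bdec; set d := spectral_diag B in Bdec dreal.
have Pu : P \in unitmx by exact: spectral_unit.
have PVE : invmx P = P ^t* by rewrite invmx_unitary ?spectral_unitarymx.
have d_ge0 j : 0 <= d 0 j ^+ 2 - toC l * d 0 j.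
  have /complex_realP[r dr] := mxOverP dreal 0 j.
  have Br : eigenvalue B (toC r).
    apply/eigenvalueP; exists (row j P).
      rewrite {1}Bdec -row_mul !mulmxA mulmxV// mul1mx row_mul row_diag_mx.
      by rewrite -scalemxAl -rowE dr.
    by apply/eqP => /(congr1 (mulmx^~ (invmx P)));
      rewrite -row_mul mulmxV// mul0mx => /rowP/(_ j); rewrite !mxE eqxx => /eqP;
      rewrite oner_eq0.
  have Ar : eigenvalue A r.
    by move: Br; rewrite !eigenvalue_root_char /B -map_char_poly fmorph_root.
  have := eigA _ Ar; rewrite dr -subr_ge0 => h.
  by rewrite -rmorphXn -rmorphM -rmorphB lecR.
pose u := (map_mx toC x)^T.
pose w := u *m invmx P.
(* [u] is real, so its conjugate transpose is [u^T] *)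
have wE : P *m u^T = w ^t*.
  rewrite /w PVE trmx_mul map_mxM trmxK map_trmx -map_mx_comp.
  rewrite (map_mx_id (@conjCK _)) /u -map_mx_comp.
  congr (_ *m _); first by rewrite trmxK.
  apply/matrixP => i j; rewrite !mxE /= conj_Creal//.
  by apply/complex_realP; exists (x i j).
have wdw (e : 'rV_N) :
    (w *m diag_mx e *m w ^t*) 0 0 = \sum_j e 0 j * (w 0 j * (w 0 j)^*).
  rewrite mxE; apply: eq_bigr => j _.
  by rewrite mul_mx_diag !mxE; ring.
have xAx : toC (dot x (A *m x)) = \sum_j d 0 j * (w 0 j * (w 0 j)^*).
  have -> : toC (dot x (A *m x)) = (u *m B *m u^T) 0 0.
    by rewrite /dot /u /B trmxK map_trmx -!map_mxM mulmxA [RHS]mxE.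
  by rewrite Bdec !mulmxA -(mulmxA _ P) wE wdw.
have AxAx : toC (dot (A *m x) (A *m x)) =
    \sum_j d 0 j ^+ 2 * (w 0 j * (w 0 j)^*).
  have -> : toC (dot (A *m x) (A *m x)) = (u *m B *m B *m u^T) 0 0.
    rewrite (dot_symmetric _ _ AT) /dot /u /B trmxK map_trmx -!map_mxM !mulmxA.
    by rewrite [RHS]mxE.
  rewrite Bdec !mulmxA mulmxK// -(mulmxA _ P) wE -(mulmxA w) mulmx_diag wdw.
  by apply: eq_bigr => j _; rewrite mxE expr2.
rewrite -(lecR (l * _)) -subr_ge0.
have -> : (l * dot x (A *m x))%:C%C = toC l * toC (dot x (A *m x)).
  exact: rmorphM.
rewrite xAx AxAx mulr_sumr -sumrB; apply: sumr_ge0 => j _.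
rewrite [toC l * _]mulrA -mulrBl mulr_ge0//.
exact: mul_conjC_ge0.
Qed.
End Spectral.

Lemma eigenvalue_size_gt0 (F : fieldType) (N : nat) (A : 'M[F]_N) m :
  eigenvalue A m -> (0 < N)%N.
Proof.
by case: N A => // A /eigenvalueP[v _]; rewrite (thinmx0 v) eqxx.
Qed.

(** * The Laplacian quadratic form *)

Section Laplacian.
Context {R : realType} {N : nat} (G : undirected_graph R N).
Local Notation L := (laplacian G).

Lemma trmx_laplacian : L^T = L.
Proof.
apply/matrixP => i j; rewrite !mxE adj_sym; congr (_ - _).
by case: eqVneq => [->|]; rewrite ?eqxx// eq_sym => /negPf->.
Qed.

Lemma laplacian_mulE (x : 'cV[R]_N) i :
  (L *m x) i 0 = \sum_j adj G i j * (x i 0 - x j 0).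
Proof.
rewrite /laplacian mulmxBl mul_diag_mx !mxE mulr_suml -sumrB.
by apply: eq_bigr => j _; rewrite mulrBr.
Qed.

Lemma dirichletE (x : 'cV[R]_N) :
  2 * dot x (L *m x) = \sum_i \sum_j adj G i j * (x i 0 - x j 0) ^+ 2.
Proof.
have E : dot x (L *m x) = \sum_i \sum_j x i 0 * (adj G i j * (x i 0 - x j 0)).
  by rewrite dotE; apply: eq_bigr => i _; rewrite laplacian_mulE mulr_sumr.
have E' : dot x (L *m x) = \sum_i \sum_j x j 0 * (adj G j i * (x j 0 - x i 0)).
  by rewrite E exchange_big.
rewrite mulr2n mulrDl mul1r {1}E E' -big_split; apply: eq_bigr => i _ /=.
by rewrite -big_split; apply: eq_bigr => j _ /=; rewrite (adj_sym G j i); ring.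
Qed.

Lemma dirichlet_ge0 (x : 'cV[R]_N) : 0 <= dot x (L *m x).
Proof.
rewrite -(pmulr_rge0 _ (ltr0Sn R 1)) dirichletE.
by do 2!(apply: sumr_ge0 => ? _); rewrite mulr_ge0 ?adj_ge0 ?sqr_ge0.
Qed.

(** A zero energy forces equal values across every edge, and connectedness
    propagates this along paths. *)
Lemma dirichlet_eq0 (x : 'cV[R]_N) :
  connected_graph G -> dot x (L *m x) = 0 -> forall i j, x i 0 = x j 0.
Proof.
move=> Gconn x0 i j.
have E0 k l : edge G k l -> x k 0 = x l 0.
  move=> kl; apply/eqP; rewrite -subr_eq0 -sqrf_eq0.
  have T_ge0 a b : 0 <= adj G a b * (x a 0 - x b 0) ^+ 2.
    by rewrite mulr_ge0 ?adj_ge0 ?sqr_ge0.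
  move/eqP: (dirichletE x); rewrite x0 mulr0 eq_sym psumr_eq0; last first.
    by move=> a _; apply: sumr_ge0.
  move=> /allP/(_ k (mem_index_enum _)) /=; rewrite psumr_eq0//.
  move=> /allP/(_ l (mem_index_enum _)) /=; rewrite mulf_eq0 => /orP[|//].
  by rewrite gt_eqF.
have [p pth ->] := connectP (Gconn i j).
elim: p i pth => //= k p IH i /andP[ik pth].
by rewrite (E0 _ _ ik); exact: IH.
Qed.

Lemma laplacian_eigenvalue_ge0 m : eigenvalue L m -> 0 <= m.
Proof.
move=> /eigenvalueP[v vL v0].
have Lv : L *m v^T = m *: v^T.
  by rewrite -{1}trmx_laplacian -trmx_mul vL linearZ.
have := dirichlet_ge0 v^T; rewrite Lv {1}/dot -scalemxAr mxE -/(dot _ _).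
by rewrite pmulr_lge0// lt_def dot_ge0 dot_eq0 trmx_eq0 v0.
Qed.

(** Every eigenvalue [m] of the Laplacian is either zero or at least [l > 0], so
    [l * m <= m ^ 2] on the whole spectrum. This bounds the squared norm of
    [L x], on which the dissipation depends, below by the energy. *)
Lemma fiedler_gap l x : smallest_nonzero_eigenvalue L l ->
  l * dot x (L *m x) <= dot (L *m x) (L *m x).
Proof.
case=> _ _ lmin; apply: symmetric_quadratic_gap trmx_laplacian _ => m Lm.
have [->|m0] := eqVneq m 0; first by rewrite mulr0 expr0n.
by rewrite expr2 ler_wpM2r ?laplacian_eigenvalue_ge0 ?lmin.
Qed.

Lemma fiedler_gt0 l : smallest_nonzero_eigenvalue L l -> 0 < l.
Proof. by case=> Ll l0 _; rewrite lt_def l0 laplacian_eigenvalue_ge0. Qed.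

End Laplacian.

(** * Absolutely continuous functions *)

Section AbsolutelyContinuous.
Context {R : realType}.
Implicit Types (a b : R) (f g h : R -> R).

Lemma ac_dominated a b f g h (K : R) : 0 <= K ->
  absolutely_continuous a b f -> absolutely_continuous a b g ->
  (forall u v, a <= u -> u <= v -> v <= b ->
     `|h v - h u| <= K * (`|f v - f u| + `|g v - g u|)) ->
  absolutely_continuous a b h.
Proof.
move=> K0 fac gac hfg e e0.
have K1 : 0 < 2 * (K + 1) by lra.
have e'0 : 0 < e / (2 * (K + 1)) by exact: divr_gt0.
have [d1 d10 f1] := fac _ e'0.
have [d2 d20 g2] := gac _ e'0.
exists (Num.min d1 d2); first by rewrite lt_min d10.
move=> n u v uv sep; rewrite lt_min.
move=> /andP[/(f1 n u v uv sep) fe /(g2 n u v uv sep) ge].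
have le : \sum_i `|h (v i) - h (u i)| <=
    K * (\sum_i `|f (v i) - f (u i)| + \sum_i `|g (v i) - g (u i)|).
  rewrite -big_split mulr_sumr; apply: ler_sum => i _.
  by have [? ? ?] := uv i; exact: hfg.
apply: (le_lt_trans le).
have eE : e = (K + 1) * (e / (2 * (K + 1)) + e / (2 * (K + 1))) by field; lra.
rewrite [ltRHS]eE; apply: (@le_lt_trans _ _ ((K + 1) *
  (\sum_i `|f (v i) - f (u i)| + \sum_i `|g (v i) - g (u i)|))).
  by rewrite ler_wpM2r ?addr_ge0 ?sumr_ge0//; lra.
by rewrite ltr_pM2l ?ltrD//; lra.
Qed.

(** Stated with increments rather than with a composition, so that a function
    of [f] only needs to be Lipschitz on the values that [f] takes. *)
Lemma ac_lipschitz a b f h (K : R) : 0 <= K -> absolutely_continuous a b f ->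
  (forall u v, a <= u -> u <= v -> v <= b ->
     `|h v - h u| <= K * `|f v - f u|) ->
  absolutely_continuous a b h.
Proof.
move=> K0 fac hf; apply: (ac_dominated K0 fac fac) => u v au uv vb.
by apply: le_trans (hf _ _ au uv vb) _; rewrite ler_wpM2l// lerDl.
Qed.

Lemma ac_id a b : absolutely_continuous a b (fun t : R => t).
Proof.
move=> e e0; exists e => // n u v uv _; congr (_ < _); apply: eq_bigr => i _.
by have [_ ? _] := uv i; rewrite ger0_norm// subr_ge0.
Qed.

Lemma ac_cst a b (c : R) : absolutely_continuous a b (fun=> c).
Proof.
by apply: (ac_lipschitz (lexx 0) (@ac_id a b)) => *; rewrite subrr normr0 mul0r.
Qed.

Lemma acD a b f g : absolutely_continuous a b f -> absolutely_continuous a b g ->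
  absolutely_continuous a b (fun t => f t + g t).
Proof.
move=> fac gac; apply: (ac_dominated ler01 fac gac) => u v _ _ _.
rewrite mul1r; apply: le_trans (ler_normD _ _); rewrite le_eqVlt; apply/orP; left.
by apply/eqP; congr (`| _ |); ring.
Qed.

Lemma acZ a b f (c : R) : absolutely_continuous a b f ->
  absolutely_continuous a b (fun t => c * f t).
Proof.
move=> fac; apply: (ac_lipschitz (normr_ge0 c) fac) => u v _ _ _.
by rewrite -mulrBr normrM.
Qed.

Lemma ac_sum a b (n : nat) (F : 'I_n -> R -> R) :
  (forall i, absolutely_continuous a b (F i)) ->
  absolutely_continuous a b (fun t => \sum_i F i t).
Proof.
move=> Fac.
elim: (index_enum _) => [|i s IH].
  rewrite (_ : (fun t => _) = fun=> 0); first exact: ac_cst.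
  by apply/funext => t; rewrite big_nil.
rewrite (_ : (fun t => _) = fun t => F i t + \sum_(j <- s) F j t).
  exact: acD.
by apply/funext => t; rewrite big_cons.
Qed.

(** Increments over steps shorter than the [d] that goes with [e := 1] are less
    than 1, and finitely many steps of length [d / 2] cross [a, b]. *)
Lemma ac_bounded a b f : absolutely_continuous a b f ->
  exists2 M : R, 0 <= M & forall t, a <= t <= b -> `|f t| <= M.
Proof.
move=> fac; have [d d0 fd] := fac 1 ltr01.
have step u v : a <= u -> u <= v -> v <= b -> v - u < d -> `|f v - f u| < 1.
  move=> au uv vb vud; have := fd 1%N (fun=> u) (fun=> v).
  rewrite !big_ord1; apply => // i j.
  by rewrite !ord1.
have grow n t : a <= t <= b -> t - a <= n%:R * (d / 2) -> `|f t - f a| <= n%:R.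
  elim: n t => [|n IH] t /andP[at_ tb] tn.
    have -> : t = a by lra.
    by rewrite subrr normr0.
  have [tad|tad] := ltP (t - a) d.
    apply: ltW; apply: lt_le_trans (step _ _ (lexx a) at_ tb tad) _.
    by rewrite ler1n.
  rewrite -natr1 in tn *.
  have -> : f t - f a = (f (t - d / 2) - f a) + (f t - f (t - d / 2)) by ring.
  apply: le_trans (ler_normD _ _) _; apply: lerD.
    apply: IH; last lra.
    by apply/andP; split; lra.
  by apply: ltW; apply: step; lra.
pose n := Num.bound ((b - a) / (d / 2)).
exists (n%:R + `|f a|); first by rewrite addr_ge0.
move=> t /andP[at_ tb].
have -> : f t = (f t - f a) + f a by ring.
apply: le_trans (ler_normD _ _) _; rewrite lerD2r; apply: grow.
  by rewrite at_ tb.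
rewrite -ler_pdivrMr; last lra.
apply: (@le_trans _ _ ((b - a) / (d / 2))).
  by rewrite ler_wpM2r// ?invr_ge0; lra.
apply: ltW; apply: archi_boundP; apply: divr_ge0; lra.
Qed.

Lemma acM a b f g : absolutely_continuous a b f -> absolutely_continuous a b g ->
  absolutely_continuous a b (fun t => f t * g t).
Proof.
move=> fac gac.
have [M M0 fM] := ac_bounded fac; have [M' M'0 gM] := ac_bounded gac.
apply: (ac_dominated (addr_ge0 M0 M'0) fac gac) => u v au uv vb.
have -> : f v * g v - f u * g u = f v * (g v - g u) + g u * (f v - f u) by ring.
apply: le_trans (ler_normD _ _) _; rewrite !normrM.
have fv : `|f v| <= M by apply: fM; rewrite vb (le_trans au).
have gu : `|g u| <= M' by apply: gM; rewrite au (le_trans uv).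
rewrite addrC mulrDr; apply: lerD; apply: ler_wpM2r => //; lra.
Qed.

Local Notation mu := (@lebesgue_measure R).

(** The straddle lemma: the derivative at [t] controls increments over small
    intervals that contain [t], with neither endpoint required to be [t]. *)
Lemma is_derive_straddle (f : R -> R) (t d e : R) :
  is_derive t 1 f d -> 0 < e ->
  exists2 r : R, 0 < r & forall u v, t - r < u -> u <= t -> t <= v -> v < t + r ->
    f v - f u <= (d + e) * (v - u).
Proof.
move=> fd e0.
have : (fun s => s^-1 *: (f (s *: 1 + t) - f t)) @ 0^' --> d.
  by rewrite -(@derive_val _ _ _ _ _ _ _ fd); exact: ex_derive.
move=> /cvgrPdist_le/(_ _ e0)/nbhs_ballP[r /= r0 fr].
exists r => // u v ru ut tv vr.
have slope s : `|s - t| < r -> s != t -> `|d - (s - t)^-1 * (f s - f t)| <= e.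
  move=> st sNt; have := fr (s - t).
  rewrite /ball/= sub0r normrN subr_eq0 => /(_ st sNt).
  by rewrite [_ *: 1]mulr1 subrK.
have up : f v - f t <= (d + e) * (v - t).
  have [->|vt] := eqVneq v t; first by rewrite !subrr mulr0.
  have vt0 : 0 < v - t by rewrite subr_gt0 lt_def vt.
  have := slope v; rewrite gtr0_norm// ltrBlDl => /(_ vr vt).
  rewrite ler_distlC => /andP[_]; rewrite mulrC.
  by rewrite ler_pdivrMr.
have dn : f t - f u <= (d + e) * (t - u).
  have [->|u_t] := eqVneq u t; first by rewrite !subrr mulr0.
  have vt0 : 0 < t - u by rewrite subr_gt0 lt_def eq_sym u_t.
  have tur : t - u < r by lra.
  have := slope u; rewrite distrC gtr0_norm// => /(_ tur u_t).
  rewrite -[u - t]opprB -[f u - f t]opprB invrN mulrNN mulrC.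
  rewrite ler_distlC => /andP[_].
  by rewrite ler_pdivrMr.
lra.
Qed.

Lemma negligible_open_cover (A : set R) (d : R) : mu.-negligible A -> 0 < d ->
  exists U : set R, [/\ open U, A `<=` U & (mu U < d%:E)%E].
Proof.
move=> negA d0.
have [B [mB muB0 AB]] : exists B : set R, [/\ measurable B, mu B = 0%E & A `<=` B].
  by case: negA => B [mB B0 AB]; exists B.
have Boo : (mu B < +oo)%E by rewrite muB0 ltry.
have [U [oU BU]] := lebesgue_regularity_outer mB Boo d0.
rewrite -[X in (X < _)%E]/(mu (U `\` B)) => UB.
exists U; split => //; first exact: subset_trans BU.
have mU : measurable U by exact: open_measurable.
rewrite -(setDUK BU) measureU//; last 2 first.
- exact: measurableD.
- by rewrite setDIK.
by rewrite [X in (X + _)%E]muB0 add0e.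
Qed.

(** Cover the null set of exceptional times by an open set [U] so small that
    disjoint intervals inside [U] contribute less than [e] to the variation of
    [f]. Around each time there is a radius such that an interval that contains
    the time and stays within the radius either lies in [U] or carries an
    increment of at most [e] times its length. A supremum argument, as for
    Cousin's lemma, chains such intervals from [a] to [b], which bounds
    [f b - f a] by [e * (b - a) + e]. *)
Lemma ac_nonincreasing (a b : R) (f : R -> R) :
  a <= b -> absolutely_continuous a b f ->
  {ae mu, forall t : R, a <= t <= b -> exists2 d : R, d <= 0 & is_derive t 1 f d} ->
  f b <= f a.
Proof.
move=> ab fac fA.
apply/ler_addgt0Pl => e' e'0.
pose D t := a <= t <= b -> exists2 d : R, d <= 0 & is_derive t 1 f d.
pose e := e' / (b - a + 1).
have ba1 : 0 < b - a + 1 by lra.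
have e0 : 0 < e by exact: divr_gt0.
have [d d0 fd] := fac _ e0.
have [U [oU AU muU]] := negligible_open_cover fA d0.
(* [m t] bounds the total length of the intervals inside [U] used up to time [t];
   it grows by the full length of an interval that lies in [U]. *)
pose m t := fine (mu (U `&` `]-oo, t])).
have mU : measurable U by exact: open_measurable.
have mUt t : measurable (U `&` `]-oo, t]) by exact: measurableI.
have mufin t : mu (U `&` `]-oo, t]) \is a fin_num.
  rewrite ge0_fin_numE//.
  apply: (@le_lt_trans _ _ (mu U)); last exact: lt_trans muU (ltry d).
  by apply: le_measure; rewrite ?inE//; exact: mUt.
have m_lt t : m t < d.
  rewrite -lte_fin fineK//; apply: le_lt_trans muU.
  by apply: le_measure; rewrite ?inE//; exact: mUt.
have m_ge0 t : 0 <= m t by exact: fine_ge0.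
have m_step u v : u <= v -> m u <= m v.
  move=> uv; apply: fine_le => //; apply: le_measure; rewrite ?inE//; try exact: mUt.
  by apply: setIS => x /=; rewrite !in_itv/= => /le_trans; apply.
have m_stepU u v : u <= v -> `[u, v] `<=` U -> m u + (v - u) <= m v.
  move=> uv uvU; rewrite -lee_fin EFinD !fineK//.
  have -> : (v - u)%:E = mu `]u, v].
    by rewrite lebesgue_measure_itv/= lte_fin; case: ltgtP uv => // -> _;
      rewrite subrr.
  rewrite -measureU//; try exact: mUt; last first.
    apply/seteqP; split => // x [[_]] /=; rewrite !in_itv/= => xu /andP[ux _].
    by move: (lt_le_trans ux xu); rewrite ltxx.
  apply: le_measure; rewrite ?inE//; try exact: mUt.
    by apply: measurableU; [exact: mUt|].
  move=> x /= [[Ux]|]; rewrite !in_itv/=.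
  - by move=> xu; split => //; exact: le_trans uv.
  - move=> /andP[ux xv]; split => //.
    by apply: uvU; rewrite /= in_itv/= (ltW ux).
(* [P t] holds when [a, t] has been crossed; [s] lists, latest first, the
   intervals inside [U] that were used. *)
pose P t := exists s : seq (R * R),
  [/\ all (fun p => [&& a <= p.1, p.1 <= p.2 & p.2 <= t]) s,
      pairwise (fun p q => q.2 <= p.1) s,
      \sum_(p <- s) (p.2 - p.1) <= m t
    & f t - f a <= e * (t - a) + \sum_(p <- s) (f p.2 - f p.1)].
have Pstep u v : a <= u -> u <= v -> P u ->
    f v - f u <= e * (v - u) \/ `[u, v] `<=` U -> P v.
  move=> au uv [s [/allP sa sp sm sf]] [fuv|uvU].
    exists s; split => //.
    - by apply/allP => p /sa/and3P[-> -> /le_trans->].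
    - exact: le_trans (m_step _ _ uv).
    - lra.
  exists ((u, v) :: s); split => /=.
  - rewrite au uv lexx; apply/allP => p /sa/and3P[-> -> /le_trans->//].
  - by rewrite sp andbT; apply/allP => p /sa/and3P[].
  - by rewrite big_cons/= (le_trans _ (m_stepU _ _ uv uvU))// addrC lerD2r.
  - rewrite big_cons/=; have : 0 <= e * (v - u) by rewrite mulr_ge0 ?subr_ge0// ltW.
    lra.
have Pa : P a.
  by exists nil; split; rewrite ?big_nil// !subrr mulr0 addr0.
have radius t : a <= t <= b -> exists2 r : R, 0 < r &
    forall u v, t - r < u -> u <= t -> t <= v -> v < t + r ->
      f v - f u <= e * (v - u) \/ `[u, v] `<=` U.
  move=> atb; have [/(_ atb)[d' d'0 fd']|nDt] := pselect (D t).
    have [r r0 fr] := is_derive_straddle fd' e0.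
    exists r => // u v ru ut tv vr; left.
    apply: le_trans (fr _ _ ru ut tv vr) _.
    by rewrite ler_wpM2r; lra.
  have /nbhs_ballP[r /= r0 rU] : nbhs t U.
    by apply: open_nbhs_nbhs; split => //; exact: AU nDt.
  exists r => // u v ru ut tv vr; right => x /=; rewrite in_itv/= => /andP[ux xv].
  by apply: rU; rewrite /ball/= ltr_distlC; apply/andP; split; lra.
pose S := [set t | a <= t <= b /\ P t].
have Sa : S a by split => //; rewrite lexx.
have Ssup : has_sup S.
  by split; [exists a|exists b => t [/andP[]]].
have S_le_sup := ub_le_sup (proj2 Ssup).
have as0 : a <= sup S by exact: S_le_sup.
have s0b : sup S <= b by apply: ge_sup; [exists a|move=> t [/andP[]]].
have [|r r0 gr] := radius (sup S); first by rewrite as0.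
have [u [/andP[au ub] Pu] ru] := sup_adherent r0 Ssup.
have us : u <= sup S by apply: S_le_sup; split=> //; rewrite au.
have Pext v : sup S <= v -> v < sup S + r -> P v.
  move=> sv vr; apply: Pstep Pu _ => //; first exact: le_trans sv.
  exact: gr.
have sb : sup S = b.
  apply/eqP; rewrite eq_le s0b leNgt; apply/negP => s_lt_b.
  pose v := Num.min b (sup S + r / 2).
  have sv : sup S < v by rewrite lt_min s_lt_b/=; lra.
  have : S v.
    split; first by rewrite ge_min lexx andbT (le_trans as0)// ltW.
    apply: Pext; first exact: ltW.
    by rewrite gt_min; apply/orP; right; lra.
  by move=> /S_le_sup; rewrite leNgt sv.
have [s [/allP sa sp sm sf]] : P b by apply: Pext; rewrite sb//; lra.
have : \sum_(p <- s) (f p.2 - f p.1) < e.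
  have nthP i : (i < size s)%N -> [&& a <= (nth (a, a) s i).1,
      (nth (a, a) s i).1 <= (nth (a, a) s i).2 & (nth (a, a) s i).2 <= b].
    by move=> ?; apply: sa; exact: mem_nth.
  have := fd (size s) (fun i => (nth (a, a) s i).1) (fun i => (nth (a, a) s i).2).
  rewrite !(big_nth (a, a)) !big_mkord => h.
  apply: le_lt_trans (h _ _ _).
  - by apply: ler_sum => i _; exact: ler_norm.
  - by move=> i; have /and3P[] := nthP _ (ltn_ord i).
  - move=> i j ij; have /pairwiseP-/(_ (a, a)) sp' := sp.
    move: ij; rewrite -val_eqE/= neq_ltn => /orP[ij|ji].
    + by right; apply: sp'; rewrite ?inE.
    + by left; apply: sp'; rewrite ?inE.
  - by move: sm; rewrite (big_nth (a, a)) big_mkord => /le_lt_trans; apply.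
have eE : e * (b - a) + e = e' by rewrite /e; field; lra.
lra.
Qed.

End AbsolutelyContinuous.

(** * Exponential estimates *)

Section ExpSum.
Context {R : realType}.

(** The tangent inequality for the exponential at [m = r / n] gives
    [a * expR a >= expR m * (a * (1 - m) + a ^ 2)]. Summing, it remains to see
    that [S * (1 - m) + r ^ 2 >= r] for [S] the sum of the [a i], which follows
    from [r <= S] and [m * S <= r ^ 2], the comparison of the 1-norm and the
    2-norm. *)
Lemma sum_mul_expR_ge (n : nat) (a : 'I_n -> R) (r : R) : (0 < n)%N ->
  (forall i, 0 <= a i) -> 0 <= r -> r ^+ 2 = \sum_i a i ^+ 2 ->
  r * expR (r / n%:R) <= \sum_i a i * expR (a i).
Proof.
move=> n0 a0 r0 rE.
set m := r / n%:R; set S := \sum_i a i.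
have nR : 0 < n%:R :> R by rewrite ltr0n.
have S0 : 0 <= S by exact: sumr_ge0.
have rS : r <= S.
  rewrite -(ler_pXn2r (ltn0Sn 1)) ?nnegrE// rE expr2 mulr_suml.
  apply: ler_sum => i _; rewrite expr2 ler_wpM2l//.
  by rewrite /S (bigD1 i)//= lerDl sumr_ge0.
have Sr : m * S <= r ^+ 2.
  rewrite /m mulrAC ler_pdivrMr// expr2 -mulrA ler_wpM2l//.
  rewrite mulr_natr -[n in _ *+ n]card_ord -sumr_const; apply: ler_sum => i _.
  rewrite -(ler_pXn2r (ltn0Sn 1)) ?nnegrE// rE (bigD1 i)//= lerDl sumr_ge0//.
  by move=> j _; rewrite sqr_ge0.
have tangent i : expR m * (a i * (1 - m) + a i ^+ 2) <= a i * expR (a i).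
  have -> : expR (a i) = expR m * expR (a i - m) by rewrite -expRD addrC subrK.
  rewrite mulrCA ler_wpM2l ?expR_ge0//.
  have -> : a i * (1 - m) + a i ^+ 2 = a i * (1 + (a i - m)) by ring.
  by rewrite ler_wpM2l// expR_ge1Dx.
apply: le_trans (ler_sum _ (fun i _ => tangent i)).
rewrite -mulr_sumr big_split/= -mulr_suml -rE -/S mulrC ler_wpM2l ?expR_ge0//.
lra.
Qed.

(** The square root is Lipschitz away from zero, and the exponential is
    1-Lipschitz on the nonpositive reals. *)
Lemma expR_sqrt_lipschitz (c q0 p q : R) : 0 <= c -> 0 < q0 -> q0 <= p -> q0 <= q ->
  `|expR (- (c * Num.sqrt p)) - expR (- (c * Num.sqrt q))| <=
    c / Num.sqrt q0 * `|p - q|.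
Proof.
move=> c0 q00 q0p q0q.
wlog qp : p q q0p q0q / q <= p.
  by move=> H; case: (leP q p) => [|/ltW] ?; [|rewrite distrC (distrC p)]; exact: H.
have sq0 : 0 < Num.sqrt q0 by rewrite sqrtr_gt0.
have sqp : Num.sqrt q <= Num.sqrt p by rewrite ler_sqrt//; lra.
have sq0q : Num.sqrt q0 <= Num.sqrt q by rewrite ler_sqrt//; lra.
have gap : Num.sqrt p - Num.sqrt q <= (p - q) / Num.sqrt q0.
  rewrite ler_pdivlMr//.
  have -> : p - q = (Num.sqrt p - Num.sqrt q) * (Num.sqrt p + Num.sqrt q).
    by rewrite -[LHS]/(p - q) -{1}[p]sqr_sqrtr -1?{1}[q]sqr_sqrtr; [ring|lra|lra].
  by rewrite ler_wpM2l; lra.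
rewrite distrC !ger0_norm ?subr_ge0//; last first.
  by rewrite ler_expR lerN2 ler_wpM2l.
have -> : expR (- (c * Num.sqrt p)) =
    expR (- (c * Num.sqrt q)) * expR (- (c * (Num.sqrt p - Num.sqrt q))).
  by rewrite -expRD; congr expR; ring.
have E1 : expR (- (c * Num.sqrt q)) <= 1.
  by rewrite -expR0 ler_expR oppr_le0 mulr_ge0// sqrtr_ge0.
have := expR_ge1Dx (- (c * (Num.sqrt p - Num.sqrt q))).
set w := expR (- (c * (_ - _))) => wge.
have cg0 : 0 <= c * (Num.sqrt p - Num.sqrt q) by rewrite mulr_ge0// subr_ge0.
have w1 : w <= 1 by rewrite -expR0 ler_expR oppr_le0.
apply: (@le_trans _ _ (c * (Num.sqrt p - Num.sqrt q))); last first.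
  by rewrite mulrAC -mulrA ler_wpM2l.
have -> : expR (- (c * Num.sqrt q)) - expR (- (c * Num.sqrt q)) * w =
   expR (- (c * Num.sqrt q)) * (1 - w) by ring.
apply: (@le_trans _ _ (1 * (1 - w))); last lra.
by rewrite ler_wpM2r// subr_ge0.
Qed.
End ExpSum.

(** * The Filippov set of the consensus field *)

Section Filippov.
Context {R : realType} {N : nat}.

Lemma lebesgue_outer0 : lebesgue_outer (set0 : set 'cV[R]_N) = 0%E.
Proof.
apply/eqP; rewrite eq_le; apply/andP; split.
  apply: ereal_inf_lbound; exists set0, (fun=> (0, 0)); split => //.
  by rewrite esum_set0.
apply: le_ereal_inf_tmp => m [D [I [_ ->]]]; apply: esum_ge0 => k _.
by rewrite lee_fin /box_volume prodr_ge0// => i _; rewrite le_max lexx.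
Qed.

(** Closed half-spaces are closed and convex, so a linear inequality that holds
    for the field on a neighbourhood passes to the Filippov set. *)
Lemma filippov_half_space (X : 'cV[R]_N -> 'cV[R]_N) (x v : 'cV[R]_N)
    (i : 'I_N) (s c d : R) :
  0 < d -> (forall z, eucl_ball x d z -> s * X z i 0 <= c) ->
  filippov X x v -> s * v i 0 <= c.
Proof.
move=> d0 Xc /(_ d d0 set0 lebesgue_outer0).
apply: (@smallest_sub _ _ _ [set w : 'cV[R]_N | s * w i 0 <= c]).
  split.
    have cc : continuous (fun w : 'cV[R]_N => s * w i 0).
      move=> w; apply: (@continuousM R _ (cst s) (fun w : 'cV[R]_N => w i 0)).
        exact: cst_continuous.
      exact: coord_continuous.
    by move/continuous_closedP: cc => /(_ _ (@closed_le R c)).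
  move=> p q l; rewrite !inE /= => pc qc.
  have -> : conv l p q =
      l%:num *: (p : 'cV[R]_N) + (1 - l%:num) *: (q : 'cV[R]_N) by [].
  rewrite !mxE.
  have l0 : 0 <= l%:num by [].
  have l1 : l%:num <= 1 by [].
  have -> : s * (l%:num * p i 0 + (1 - l%:num) * q i 0) =
     l%:num * (s * p i 0) + (1 - l%:num) * (s * q i 0) by ring.
  nra.
by move=> _ [z [xz _] <-]; exact: Xc.
Qed.

Lemma eucl_norm_coord (z : 'cV[R]_N) j : `|z j 0| <= eucl_norm z.
Proof.
rewrite -sqrtr_sqr ler_sqrt; last by rewrite sumr_ge0// => k _; rewrite sqr_ge0.
by rewrite (bigD1 j)//= lerDl sumr_ge0// => k _; rewrite sqr_ge0.
Qed.

Lemma mulmx_coord_ball (A : 'M[R]_N) (x : 'cV[R]_N) (i : 'I_N) (e : R) : 0 < e ->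
  exists2 d, 0 < d &
    forall z, eucl_ball x d z -> `|(A *m z) i 0 - (A *m x) i 0| < e.
Proof.
move=> e0; pose C := \sum_j `|A i j|.
have C0 : 0 <= C by exact: sumr_ge0.
exists (e / (C + 1)); first by rewrite divr_gt0//; lra.
move=> z; rewrite /eucl_ball /= => zx.
have -> : (A *m z) i 0 - (A *m x) i 0 = (A *m (z - x)) i 0.
  by rewrite mulmxBr !mxE.
rewrite mxE; apply: le_lt_trans (ler_norm_sum _ _ _) _.
have n0 : 0 <= eucl_norm (z - x) by exact: sqrtr_ge0.
apply: (@le_lt_trans _ _ (C * eucl_norm (z - x))).
  rewrite mulr_suml; apply: ler_sum => j _.
  by rewrite normrM ler_wpM2l// eucl_norm_coord.
move: zx; rewrite ltr_pdivlMr; last lra.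
by apply: le_lt_trans; nra.
Qed.

(** Where a coordinate of [A x] is nonzero, that coordinate of the field is
    continuous at [x], and the Filippov set keeps its value; where it vanishes,
    both sides are zero whatever [v] is. *)
Lemma filippov_sign_exp (A : 'M[R]_N) (alpha : R) (x v : 'cV[R]_N) (i : 'I_N) :
  0 <= alpha -> filippov (fun z => - sign_exp alpha (A *m z)) x v ->
  (A *m x) i 0 * v i 0 <= - (alpha * (`|(A *m x) i 0| * expR `|(A *m x) i 0|)).
Proof.
move=> a0 xv; set y := (A *m x) i 0.
have [->|y0] := eqVneq y 0; first by rewrite normr0 !(mul0r, mulr0) oppr0.
have ny0 : 0 < `|y| by rewrite normr_gt0.
suff sv : Num.sg y * v i 0 <= - (alpha * expR `|y|).
  have -> : y * v i 0 = `|y| * (Num.sg y * v i 0).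
    by rewrite mulrA [`|y| * _]mulrC -numEsg.
  have -> : - (alpha * (`|y| * expR `|y|)) = `|y| * - (alpha * expR `|y|) by ring.
  by rewrite ler_wpM2l.
apply/ler_addgt0Pr => e e0.
pose B := alpha * expR `|y|.
have B0 : 0 <= B by rewrite mulr_ge0// expR_ge0.
(* Over a distance below [h], the coordinate keeps its sign because [h <= |y|],
   and [alpha * expR |_|] drops by at most [h * B <= e]. *)
pose h := Num.min `|y| (e / (B + 1)).
have h0 : 0 < h by rewrite lt_min ny0 divr_gt0//; lra.
have hB : h * (B + 1) <= e by rewrite -ler_pdivlMr ?ge_min ?lexx ?orbT//; lra.
have [d d0 xd] := mulmx_coord_ball A x i h0.
apply: (filippov_half_space d0 _ xv) => z /xd.
set w := (A *m z) i 0; rewrite -/y => wy.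
have -> : (- sign_exp alpha (A *m z)) i 0 = - (alpha * (Num.sg w * expR `|w|)).
  by rewrite /sign_exp mxE mxE.
have hy : h <= `|y| by rewrite ge_min lexx.
have sgw : Num.sg w = Num.sg y.
  move: wy hy; rewrite ltr_distl => /andP[w1 w2].
  case: (ltgtP y 0) => [yn|yp|/eqP]; last by rewrite (negPf y0).
    by rewrite ltr0_norm// => hy; rewrite !ltr0_sg//; lra.
  by rewrite gtr0_norm// => hy; rewrite !gtr0_sg//; lra.
have nw : `|y| - h <= `|w|.
  have := ler_normD (y - w) w; rewrite subrK => yw.
  by move: wy; rewrite distrC; lra.
rewrite sgw.
have -> : Num.sg y * - (alpha * (Num.sg y * expR `|w|)) =
    - ((Num.sg y * Num.sg y) * (alpha * expR `|w|)) by ring.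
rewrite -expr2 sqr_sg y0 mul1r lerNl opprD opprK.
apply: (@le_trans _ _ (B * (1 - h))).
  rewrite mulrBr mulr1 lerD2l lerN2; nra.
rewrite /B -mulrA ler_wpM2l//.
apply: (@le_trans _ _ (expR `|y| * expR (- h))).
  by rewrite ler_wpM2l ?expR_ge0// expR_ge1Dx.
by rewrite -expRD ler_expR.
Qed.
End Filippov.

(** * The energy along a solution *)

Section QuadraticForm.
Context {R : realType} {N : nat} (A : 'M[R]_N).

Lemma quadratic_formE (z : 'cV[R]_N) :
  dot z (A *m z) = \sum_i z i 0 * \sum_j A i j * z j 0.
Proof. by rewrite dotE; apply: eq_bigr => i _; rewrite mxE. Qed.

Lemma ac_quadratic_form (a b : R) (x : R -> 'cV[R]_N) :
  (forall i, absolutely_continuous a b (fun t => x t i 0)) ->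
  absolutely_continuous a b (fun t => dot (x t) (A *m x t)).
Proof.
move=> xac; under eq_fun do rewrite quadratic_formE.
apply: (@ac_sum _ _ _ _ (fun i t => x t i 0 * \sum_j A i j * x t j 0)) => i.
apply: (acM (xac i)); apply: (@ac_sum _ _ _ _ (fun j t => A i j * x t j 0)) => j.
exact: acZ.
Qed.

Lemma is_derive_quadratic_form (x : R -> 'cV[R]_N) (t : R) (v : 'cV[R]_N) :
  A^T = A -> (forall i, is_derive t (1 : R) (fun s => x s i 0) (v i 0)) ->
  is_derive t (1 : R) (fun s => dot (x s) (A *m x s)) (2 * dot (A *m x t) v).
Proof.
move=> AT xv; under eq_fun do rewrite quadratic_formE.
have dA i : is_derive t (1 : R) (fun s => \sum_j A i j * x s j 0)
    (\sum_j A i j * v j 0).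
  have := @is_derive_sum _ _ _ _ (fun j s => A i j * x s j 0) t 1
    (fun j => A i j *: v j 0)
    (fun j => @is_deriveZ _ _ _ (fun s => x s j 0) (A i j) t 1 (v j 0) (xv j)).
  by rewrite fct_sumE.
have := @is_derive_sum _ _ _ _ (fun i s => x s i 0 * \sum_j A i j * x s j 0) t 1
   (fun i => x t i 0 *: (\sum_j A i j * v j 0) + (\sum_j A i j * x t j 0) *: v i 0)
   (fun i => is_deriveM (xv i) (dA i)).
rewrite fct_sumE => h; apply: is_derive_eq h _.
rewrite big_split/= mulr2n mulrDl mul1r; congr (_ + _).
  by rewrite dot_symmetric// dotE; apply: eq_bigr => i _; rewrite mxE.
by rewrite dotE; apply: eq_bigr => i _; rewrite mxE.
Qed.

End QuadraticForm.

Section Consensus.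
Context {R : realType} {N : nat} (G : undirected_graph R N).
Context (lambda2 alpha : R) (x : R -> 'cV[R]_N).
Context (Gconn : connected_graph G).
Context (L2 : smallest_nonzero_eigenvalue (laplacian G) lambda2).
Context (alpha0 : 0 < alpha).
Local Notation L := (laplacian G).
Context (xsol : filippov_solution (fun z => - sign_exp alpha (L *m z)) x).

Let V (t : R) := dot (x t) (L *m x t).

(** A lower bound for the norm of [L x] in terms of the energy. *)
Let speed (t : R) := Num.sqrt (lambda2 * V t).

Let N0 : (0 < N)%N.
Proof. by have [/eigenvalue_size_gt0] := L2. Qed.

Let V_ac (a b : R) : 0 <= a -> a <= b -> absolutely_continuous a b V.
Proof.
by move=> a0 ab; apply: ac_quadratic_form => i; have [+ _] := xsol; apply.
Qed.

(** The coordinatewise Filippov bound gives the sum of the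
    [|y_i| * expR |y_i|] for [y = L x]. That sum is bounded below through the
    norm of [y], and the norm through the energy by the spectral gap. *)
Lemma energy_dissipation (t : R) (v : 'cV[R]_N) :
  filippov (fun z => - sign_exp alpha (L *m z)) (x t) v ->
  dot (L *m x t) v <= - (alpha * (speed t * expR (speed t / N%:R))).
Proof.
move=> xv; rewrite /speed; set r := Num.sqrt (lambda2 * V t); set y := L *m x t.
pose r' := Num.sqrt (dot y y).
have rr' : r <= r' by rewrite ler_sqrt ?dot_ge0//; exact: fiedler_gap.
have r0 : 0 <= r by exact: sqrtr_ge0.
have rr : r * expR (r / N%:R) <= r' * expR (r' / N%:R).
  by rewrite ler_pM ?expR_ge0// ler_expR ler_wpM2r// invr_ge0.
have h : r' * expR (r' / N%:R) <= \sum_i `|y i 0| * expR `|y i 0|.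
  apply: sum_mul_expR_ge => //; first exact: sqrtr_ge0.
  rewrite sqr_sqrtr ?dot_ge0// dotE; apply: eq_bigr => i _.
  by rewrite real_normK ?num_real.
apply: (@le_trans _ _ (- (alpha * \sum_i `|y i 0| * expR `|y i 0|))).
  rewrite dotE mulr_sumr -sumrN; apply: ler_sum => i _.
  exact: filippov_sign_exp (ltW alpha0) xv.
by rewrite lerN2 ler_wpM2l ?(ltW alpha0)// (le_trans rr).
Qed.

Lemma energy_derivative (t : R) :
  (exists2 v, filippov (fun z => - sign_exp alpha (L *m z)) (x t) v &
     forall i, is_derive t (1 : R) (fun s => x s i 0) (v i 0)) ->
  exists2 d, d <= - (2 * alpha * (speed t * expR (speed t / N%:R))) &
    is_derive t (1 : R) V d.
Proof.
move=> [v xv dx]; exists (2 * dot (L *m x t) v).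
  have := energy_dissipation xv; lra.
exact: is_derive_quadratic_form (trmx_laplacian G) dx.
Qed.

Lemma energy_nonincreasing (s t : R) : 0 <= s -> s <= t -> V t <= V s.
Proof.
move=> s0 st; apply: ac_nonincreasing => //; first exact: V_ac.
have [_ dyn] := xsol; apply: negligibleS dyn => u; apply: contra_not => uP /andP[su ut].
have [d dle dV] := energy_derivative (uP (le_trans s0 su)).
exists d => //; apply: le_trans dle _; rewrite oppr_le0.
by rewrite !mulr_ge0 ?expR_ge0 ?sqrtr_ge0// ltW.
Qed.

(** With [c * sqrt V = speed / N], the dissipation bound says that [h] grows at
    rate at least [alpha * lambda2 / N] wherever [V > 0]. *)
Let c := Num.sqrt lambda2 / N%:R.
Let h (t : R) := expR (- (c * Num.sqrt (V t))).

(** If [V] were positive at time [T], it would be at least [V T] on all of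
    [0, T], where [h] would then be absolutely continuous and gain at least 1;
    but [h] takes its values in the interval ]0, 1]. *)
Lemma energy_vanishes : V (N%:R / (alpha * lambda2)) = 0.
Proof.
set T := N%:R / _.
have l0 : 0 < lambda2 := fiedler_gt0 L2.
have nR : 0 < N%:R :> R by rewrite ltr0n.
have T0 : 0 <= T by rewrite divr_ge0// mulr_ge0// ltW.
apply/eqP; rewrite eq_le dirichlet_ge0 andbT leNgt; apply/negP => VT.
have V_ge t : 0 <= t <= T -> V T <= V t.
  by move=> /andP[? ?]; exact: energy_nonincreasing.
have c0 : 0 < c by rewrite divr_gt0// sqrtr_gt0.
pose k := alpha * lambda2 / N%:R.
have k0 : 0 < k by rewrite divr_gt0// mulr_gt0.
have kT : k * T = 1 by rewrite /k /T; field; rewrite !gt_eqF.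
have h_ac : absolutely_continuous 0 T h.
  have K0 : 0 <= c / Num.sqrt (V T) by rewrite divr_ge0 ?sqrtr_ge0// ltW.
  apply: (ac_lipschitz K0 (V_ac (lexx 0) T0)) => u v u0 uv vT.
  apply: expR_sqrt_lipschitz => //; first exact: ltW.
    by apply: V_ge; rewrite vT (le_trans u0).
  by apply: V_ge; rewrite u0 (le_trans uv).
have : k * T + -1 * h T <= k * 0 + -1 * h 0.
  apply: (@ac_nonincreasing _ 0 T (fun t => k * t + -1 * h t) T0).
    by apply: acD; apply: acZ => //; exact: ac_id.
  have [_ dyn] := xsol; apply: negligibleS dyn => t; apply: contra_not => tP t0T.
  have [/= d dle dV] := energy_derivative (tP (proj1 (andP t0T))).
  have Vt0 : 0 < V t by apply: lt_le_trans VT (V_ge _ t0T).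
  have sV : 0 < Num.sqrt (V t) by rewrite sqrtr_gt0.
  set q := Num.sqrt (V t) in sV.
  have dsqrt := is_derive1_comp (is_derive1_sqrt Vt0) dV.
  have dh := is_derive1_comp (is_derive_expR _) (is_deriveN (is_deriveZ c dsqrt)).
  have df := is_deriveD (is_deriveZ k (is_derive_id t 1)) (is_deriveZ (-1) dh).
  exists (k *: 1 + -1 *: (expR (- (c * q)) * (- (c *: ((2 * q)^-1 * d)))));
    last exact: df.
  have rE : speed t = Num.sqrt lambda2 * q by rewrite /speed sqrtrM// ltW.
  have rNE : speed t / N%:R = c * q by rewrite rE /c; ring.
  have lE : Num.sqrt lambda2 ^+ 2 = lambda2 by rewrite sqr_sqrtr// ltW.
  rewrite rNE {}rE in dle.
  have slope : c / (2 * q) * d <= - (k * expR (c * q)).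
    have -> : - (k * expR (c * q)) =
        c / (2 * q) * - (2 * alpha * (Num.sqrt lambda2 * q * expR (c * q))).
      by rewrite /k -{1}lE /c; field; rewrite !gt_eqF.
    by rewrite ler_wpM2l// divr_ge0 ?mulr_ge0// ltW.
  have -> : k *: 1 + -1 *: (expR (- (c * q)) * (- (c *: ((2 * q)^-1 * d)))) =
      k + expR (- (c * q)) * (c / (2 * q) * d).
    by rewrite /GRing.scale/=; ring.
  have -> : 0 = k + expR (- (c * q)) * - (k * expR (c * q)).
    by rewrite mulrN mulrCA -expRD addNr expR0 mulr1 subrr.
  by rewrite lerD2l ler_wpM2l ?expR_ge0.
rewrite mulr0 add0r kT !mulN1r => hT.
have := expR_gt0 (- (c * Num.sqrt (V 0))).
have : h T <= 1.
  by rewrite -expR0 ler_expR oppr_le0 mulr_ge0 ?sqrtr_ge0// ltW.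
rewrite -/(h 0); lra.
Qed.

Lemma consensus_at (t : R) : N%:R / (alpha * lambda2) <= t ->
  exists a : R, x t = a *: const_mx 1.
Proof.
move=> Tt.
have T0 : 0 <= N%:R / (alpha * lambda2).
  by rewrite divr_ge0// mulr_ge0// ltW// (fiedler_gt0 L2).
have Vt : V t = 0.
  apply/eqP; rewrite eq_le dirichlet_ge0 andbT.
  by rewrite -energy_vanishes; exact: energy_nonincreasing.
exists (x t (Ordinal N0) 0); apply/colP => i; rewrite !mxE mulr1.
exact: dirichlet_eq0 Gconn Vt _ _.
Qed.
End Consensus.

Theorem corollary2 (R : realType) (N : nat) (G : undirected_graph R N)
    (lambda2 alpha : R) :
  connected_graph G ->
  smallest_nonzero_eigenvalue (laplacian G) lambda2 ->
  0 < alpha ->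
  exists T : R, 0 <= T /\ T <= N%:R / (alpha * lambda2) /\
    forall (x0 : 'cV[R]_N) (x : R -> 'cV[R]_N),
      filippov_solution (fun z => - sign_exp alpha (laplacian G *m z)) x ->
      x 0 = x0 ->
      consensus_in_time T x.
Proof.
move=> Gconn L2 alpha0; exists (N%:R / (alpha * lambda2)); split.
  by rewrite divr_ge0// mulr_ge0// ltW// (fiedler_gt0 L2).
split=> // x0 x xsol _ t; exact: (consensus_at Gconn L2 alpha0 xsol).
Qed.
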